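(* Let $m>n$ be coprime positive integers with $m\not\equiv n \pmod 2$, such that $4\mid m$ and $8\nmid m$. If $(x,y,z)$ are positive integers with $$(m^2-n^2)^x+(2mn)^y=(m^2+n^2)^z,$$ then either $y=1$ or $x\equiv y\equiv z\equiv 0\pmod 2$. *)

(* Defs.v *)
From mathcomp Require Export all_boot.

(* Main.v *)
Require Import Defs.
From mathcomp Require Import all_boot.
From mathcomp Require Import all_order all_algebra zify ring.
Set Implicit Arguments. Unset Strict Implicit. Unset Printing Implicit Defensive.
Import Order.TTheory GRing.Theory Num.Theory.

(* Write a = m^2 - n^2, b = 2mn, c = m^2 + n^2, and assume y > 1. Congruences
   modulo 16 and Jacobi symbols modulo m - n and m + n leave, besides the case
   where x, y, z are all even, only two possibilities.

   If x is even, y and z are odd and n = 1 mod 8, then b = (m + n)^2 mod c turns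
   the equation into P^2 = Q^2 mod c with P = n (m + n)^y and Q = m a^(x/2).
   Since -1 = (m/n)^2 is a square mod c, PQ is then a square mod c, which gives
   ((m + n)/c) = 1, whereas reciprocity gives ((m + n)/c) = (2/(m + n)) = -1.

   If x = 2X and z = 2Z are even, y is odd and n = 5 mod 8, one descends on
   c^(2Z) = a^(2X) + 2^e (uv)^y with u | m odd, v | n and v = 5 mod 8. With
   A = (-a)^X the factors are c^Z + A = 2 s^y and c^Z - A = 2^(e-1) r^y, where
   rs = uv and X, Z have the same parity. A divisor of s or r dividing m or n
   often divides a sum of two fourth powers, hence is 1 mod 8. For X odd this
   forces v = 1 mod 8; for X even it shows that the n-part of r is again
   5 mod 8, and c^Z - A = 2^(e-1) r^y is a smaller instance. *)

(** * The Jacobi symbol through least absolute residues *)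

Section Jacobi.
Local Open Scope ring_scope.

Definition gauss_res (N : nat) (a : int) (k : nat) : nat := `|(a * k%:Z %% N)%Z|%N.
Definition gauss_neg N a k : bool := (N./2 < gauss_res N a k)%N.
Definition gauss_abs N a k : nat :=
  if gauss_neg N a k then (N - gauss_res N a k)%N else gauss_res N a k.

(* The bit of the Jacobi symbol: [true] stands for -1. By the lemma of Gauss and
   Schering this product of signs is the Jacobi symbol (a/N) for every odd N
   coprime to a, so composite moduli need no factorization. *)
Definition jacobi N a : bool := \big[addb/false]_(k <- iota 1 N./2) gauss_neg N a k.

Variable N : nat.
Hypothesis oddN : odd N.

Let N_gt0 : (0 < N)%N. Proof. by case: N oddN. Qed.
Let N_eq : N = N./2.*2.+1. Proof. by rewrite -{1}(odd_double_half N) oddN. Qed.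

Lemma gauss_resE a k : (gauss_res N a k)%:Z = (a * k%:Z %% N)%Z.
Proof. by rewrite /gauss_res gez0_abs // modz_ge0 //; lia. Qed.

Lemma gauss_res_lt a k : (gauss_res N a k < N)%N.
Proof. by rewrite -ltz_nat gauss_resE ltz_pmod //; lia. Qed.

Lemma gauss_absP a k :
  (N%:Z %| a * k%:Z - (-1) ^+ gauss_neg N a k * (gauss_abs N a k)%:Z)%Z.
Proof.
have H : (N%:Z %| a * k%:Z - (gauss_res N a k)%:Z)%Z.
  by rewrite -eqz_mod_dvd gauss_resE modz_mod.
rewrite /gauss_abs; case: ifP => _; last by rewrite expr0 mul1r.
rewrite expr1 -subzn ?(ltnW (gauss_res_lt a k)) //.
rewrite (_ : _ - _ = (a * k%:Z - (gauss_res N a k)%:Z) + N%:Z); last by ring.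
by rewrite rpredD ?dvdzz.
Qed.

Lemma gauss_abs_le a k : (gauss_abs N a k <= N./2)%N.
Proof. by rewrite /gauss_abs /gauss_neg; case: ltnP => //; lia. Qed.

Lemma gauss_abs_gt0 a k : coprimez N a -> k \in iota 1 N./2 -> (0 < gauss_abs N a k)%N.
Proof.
move=> co; rewrite mem_iota => hk; rewrite lt0n; apply/negP => /eqP h0.
have := gauss_absP a k; rewrite h0 mulr0 subr0 Gauss_dvdzr // dvdzE => /dvdn_leq.
by lia.
Qed.

(** The map is injective: equal values at [k] and [l] make [N] divide [k - l] or [k + l], and both
    are too small unless [k = l]. *)
Lemma gauss_abs_perm a : coprimez N a ->
  perm_eq (map (gauss_abs N a) (iota 1 N./2)) (iota 1 N./2).
Proof.
move=> co.
have sub : {subset map (gauss_abs N a) (iota 1 N./2) <= iota 1 N./2}.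
  move=> _ /mapP [k hk ->]; rewrite mem_iota gauss_abs_gt0 //=.
  by rewrite add1n ltnS gauss_abs_le.
have un : uniq (map (gauss_abs N a) (iota 1 N./2)).
  rewrite map_inj_in_uniq ?iota_uniq // => k l hk hl e.
  have Hk := gauss_absP a k; have := gauss_absP a l; rewrite -e => Hl.
  move: hk hl; rewrite !mem_iota => hk hl.
  have D : (N%:Z %| k%:Z - l%:Z)%Z \/ (N%:Z %| k%:Z + l%:Z)%Z.
    case: (boolP (gauss_neg N a k == gauss_neg N a l)) => [/eqP eg|ng].
      left; rewrite -(Gauss_dvdzr _ co).
      rewrite (_ : a * _ = (a * k%:Z - (-1) ^+ gauss_neg N a k * (gauss_abs N a k)%:Z) - 
         (a * l%:Z - (-1) ^+ gauss_neg N a l * (gauss_abs N a k)%:Z)); first by rewrite rpredB.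
      by rewrite eg; ring.
    right; rewrite -(Gauss_dvdzr _ co).
    rewrite (_ : a * _ = (a * k%:Z - (-1) ^+ gauss_neg N a k * (gauss_abs N a k)%:Z) + 
         (a * l%:Z - (-1) ^+ gauss_neg N a l * (gauss_abs N a k)%:Z)); first by rewrite rpredD.
    by move: ng; case: gauss_neg; case: gauss_neg => // _; rewrite expr0 expr1; ring.
  case: D; rewrite dvdzE => D; apply/eqP; apply/negPn/negP => nkl; have := dvdn_leq _ D; lia.
apply: uniq_perm; rewrite ?iota_uniq //.
by have [] := uniq_min_size un sub _; rewrite ?size_map.
Qed.

Lemma eq_jacobi a b : (N%:Z %| a - b)%Z -> jacobi N a = jacobi N b.
Proof.
move=> /dvdzP [q e]; apply: eq_bigr => k _; rewrite /gauss_neg /gauss_res.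
have -> : a = q * N%:Z + b by rewrite -e; ring.
by rewrite (_ : _ * k%:Z = q * k%:Z * N%:Z + b * k%:Z) ?modzMDl //; ring.
Qed.

(** The product for [a] is reindexed by [l = gauss_abs N b k]; the sign of [a * b * k] is then the
    sign of [b * k] times that of [a * l]. *)
Lemma jacobiM a b : coprimez N a -> coprimez N b ->
  jacobi N (a * b) = jacobi N a (+) jacobi N b.
Proof.
move=> ca cb; rewrite {2}/jacobi -(perm_big _ (gauss_abs_perm cb)) big_map -big_split /=.
apply: eq_big_seq => k hk.
have Hb := gauss_absP b k; set l := gauss_abs N b k in Hb *.
have hl : l \in iota 1 N./2.
  by rewrite -(perm_mem (gauss_abs_perm cb)); apply/mapP; exists k.
have Ha := gauss_absP a l; have Hab := gauss_absP (a * b) k.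
have ga := gauss_abs_gt0 ca hl; have la := gauss_abs_le a l.
have cab : coprimez N (a * b) by rewrite coprimezMr ca.
have gab := gauss_abs_gt0 cab hk; have lab := gauss_abs_le (a * b) k.
set s := gauss_neg N (a * b) k in Hab *; set t := gauss_neg N a l in Ha *.
set u := gauss_neg N b k in Hb *.
have : (N%:Z %| (-1) ^+ s * (gauss_abs N (a * b) k)%:Z
         - (-1) ^+ (t (+) u) * (gauss_abs N a l)%:Z)%Z.
  rewrite signr_addb (_ : _ - _ = a * (b * k%:Z - (-1) ^+ u * l%:Z)
     + (-1) ^+ u * (a * l%:Z - (-1) ^+ t * (gauss_abs N a l)%:Z)
     - (a * b * k%:Z - (-1) ^+ s * (gauss_abs N (a * b) k)%:Z)); last by ring.
  by apply: rpredB => //; apply: rpredD; apply: dvdz_mull.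
move: (t (+) u) => v; case: s {Hab}; case: v => //; rewrite expr0 expr1 dvdzE => D;
  have := dvdn_leq _ D; lia.
Qed.

Lemma jacobi1 : jacobi N 1 = false.
Proof. by have := @jacobiM 1 1; rewrite mulr1 addbb; apply; rewrite /coprimez gcdz1. Qed.

Lemma jacobiX a n : coprimez N a -> jacobi N (a ^+ n) = odd n && jacobi N a.
Proof.
move=> ca; elim: n => [|n IH]; first by rewrite expr0 jacobi1.
by rewrite exprS jacobiM ?coprimezXr // IH /=; case: odd; case: jacobi.
Qed.

Lemma big_addb_true (r : seq nat) : \big[addb/false]_(k <- r) true = odd (size r).
Proof. by elim: r => [|k r IH]; rewrite ?big_nil // big_cons IH. Qed.

Lemma jacobiN1 : jacobi N (-1) = odd N./2.
Proof.
rewrite -[in RHS](size_iota 1 N./2) -big_addb_true; apply: eq_big_seq => k.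
rewrite mem_iota => hk; rewrite /gauss_neg /gauss_res.
rewrite (_ : -1 * k%:Z = -1 * N%:Z + (N - k)%N%:Z); last by lia.
by rewrite modzMDl modz_nat modn_small; lia.
Qed.

(** With [h = N./2], the residue [2 * k] exceeds [h] exactly for [k > h./2], which leaves [uphalf h]
    indices. *)
Lemma jacobi2 : jacobi N 2 = odd (uphalf N./2).
Proof.
rewrite /jacobi; set h := N./2.
have -> : iota 1 h = iota 1 h./2 ++ iota (1 + h./2) (uphalf h).
  by rewrite -iotaD; congr iota; rewrite uphalf_half; lia.
rewrite big_cat /= big1_seq => [|k]; last first.
  rewrite mem_iota /= => hk; rewrite /gauss_neg /gauss_res.
  by rewrite (_ : 2 * k%:Z = (k * 2)%N%:Z) ?modz_nat ?modn_small; lia.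
rewrite addFb -[in RHS](size_iota (1 + h./2) (uphalf h)) -big_addb_true.
apply: eq_big_seq => k; rewrite mem_iota uphalf_half /= => hk; rewrite /gauss_neg /gauss_res.
by rewrite (_ : 2 * k%:Z = (k * 2)%N%:Z) ?modz_nat ?modn_small; lia.
Qed.

Lemma odd_count_le q h : (q <= h)%N ->
  odd q = \big[addb/false]_(l <- iota 1 h) (l <= q)%N.
Proof.
move=> /subnKC <-; rewrite iotaD big_cat /= [X in _ (+) X]big1_seq ?addbF => [|l].
  rewrite -[LHS](congr1 odd (size_iota 1 q)) -big_addb_true.
  by apply: eq_big_seq => l; rewrite mem_iota; lia.
by rewrite mem_iota /=; lia.
Qed.

(* Eisenstein's lattice-point count *)
Lemma jacobi_lattice M : odd M -> coprime N M ->
  jacobi N M%:Z =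
  \big[addb/false]_(k <- iota 1 N./2) \big[addb/false]_(l <- iota 1 M./2) (N * l <= M * k)%N.
Proof.
move=> oM co.
(* Parities in the division of [M * k] by [N], both odd; passing from a residue to [N] minus it
   flips the parity. *)
have e k : k \in iota 1 N./2 -> odd k = \big[addb/false]_(l <- iota 1 M./2) (N * l <= M * k)%N
    (+) odd (gauss_abs N M%:Z k) (+) gauss_neg N M%:Z k.
  rewrite mem_iota => hk.
  have -> : \big[addb/false]_(l <- iota 1 M./2) (N * l <= M * k)%N = odd (M * k %/ N)%N.
    rewrite (@odd_count_le _ M./2); last first.
      rewrite -ltnS ltn_divLR //; move: (odd_double_half M) N_eq; rewrite oM.
      by nia.
    by apply: eq_bigr => l _; rewrite leq_divRL // mulnC.
  have r : gauss_res N M%:Z k = (M * k %% N)%N.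
    by apply/eqP; rewrite -eqz_nat gauss_resE -PoszM modz_nat.
  have re := gauss_res_lt M%:Z k; rewrite r in re.
  have := congr1 odd (divn_eq (M * k) N).
  rewrite oddD !oddM oddN oM /= andbT => ->.
  rewrite /gauss_abs; case: ifP => _; rewrite ?r ?oddB ?oddN ?(ltnW re) //=.
    by case: odd; case: odd.
  by case: odd; case: odd.
have perm := gauss_abs_perm (a := M%:Z) co.
(* [gauss_abs] permutes the range, so its parities sum to those of [k] and cancel. *)
have E : \big[addb/false]_(k <- iota 1 N./2) odd k =
  \big[addb/false]_(k <- iota 1 N./2) \big[addb/false]_(l <- iota 1 M./2) (N * l <= M * k)%N
  (+) \big[addb/false]_(k <- iota 1 N./2) odd k (+) jacobi N M%:Z.
  rewrite -{2}(perm_big _ perm) big_map -!big_split /=.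
  exact: eq_big_seq.
by move: E; case: (\big[_/_]_(k <- _) odd k); case: jacobi; case: (\big[_/_]_(k <- _) _).
Qed.

End Jacobi.

(** * Quadratic reciprocity and its supplements *)

(** No lattice point of the rectangle lies on the diagonal [M * k = N * l], so the two counts add up
    to [M./2 * N./2], which is even. *)
Lemma jacobi_reciprocity M N : odd M -> odd N -> coprime M N -> ~~ odd N./2 ->
  jacobi M N = jacobi N M.
Proof.
move=> oM oN co eN; rewrite !jacobi_lattice // 1?coprime_sym //.
rewrite exchange_big /=; apply/eqP; rewrite -negb_add -big_split /=.
have e k : k \in iota 1 N./2 -> \big[addb/false]_(l <- iota 1 M./2) (M * k <= N * l)
    (+) \big[addb/false]_(l <- iota 1 M./2) (N * l <= M * k) = odd M./2.
  rewrite mem_iota -big_split /= -[in RHS](size_iota 1 M./2) -big_addb_true => hk.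
  apply: eq_big_seq => l; rewrite mem_iota => hl.
  have : M * k != N * l.
    apply/eqP => E; have : M %| l by rewrite -(Gauss_dvdr _ co) -E dvdn_mulr.
    by move/dvdn_leq; lia.
  by case: ltngtP.
rewrite (eq_big_seq _ e); case: (odd M./2); first by rewrite big_addb_true size_iota.
by rewrite big1_seq.
Qed.

Lemma jacobi2_mod8 N : odd N -> jacobi N 2 = (N %% 8 == 3) || (N %% 8 == 5).
Proof. by move=> oN; rewrite jacobi2 // uphalf_half; lia. Qed.

Lemma jacobiN1_mod8 N : odd N -> jacobi N (-1) = (N %% 8 == 3) || (N %% 8 == 7).
Proof. by move=> oN; rewrite jacobiN1 //; lia. Qed.

(** * Odd divisors of sums of two fourth powers *)

Section Arith.
Local Open Scope ring_scope.

Lemma coprimez_congr (d a b : int) : (d %| a - b)%Z -> coprimez d b -> coprimez d a.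
Proof. by move=> /dvdzP [q e]; rewrite -(subrK b a) e /coprimez gcdzMDl. Qed.

Lemma dvdz_subX (d a b : int) k : (d %| a - b)%Z -> (d %| a ^+ k - b ^+ k)%Z.
Proof. by move=> h; rewrite subrXX; apply: dvdz_mulr. Qed.

Lemma coprimez_odd2 (N : nat) : odd N -> coprimez N 2.
Proof. by move=> oN; rewrite coprimezE coprime_sym coprime2n. Qed.

Lemma jacobi_sqr N a : odd N -> coprimez N a -> jacobi N (a ^+ 2) = false.
Proof. by move=> oN ca; rewrite jacobiX. Qed.

(** Modulo [N], [f ^+ 4 = - g ^+ 4] and [(f ^+ 2 + g ^+ 2) ^+ 2 = 2 * (f * g) ^+ 2], so -1 and 2
    both have symbol 1, which leaves only the class 1 modulo 8. *)
Lemma sum_fourth_powers_mod8 (N : nat) (f g : int) : odd N -> coprimez N f -> coprimez N g ->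
  (N%:Z %| f ^+ 4 + g ^+ 4)%Z -> (N %% 8 = 1)%N.
Proof.
move=> oN cf cg dv.
have c2 := coprimez_odd2 oN.
have cN1 : coprimez N (-1) by rewrite coprimezN /coprimez gcdz1.
have JN : ~~ jacobi N (-1).
  have : jacobi N ((f ^+ 2) ^+ 2) = jacobi N (-1 * (g ^+ 2) ^+ 2).
    by apply: eq_jacobi; rewrite (_ : _ - _ = f ^+ 4 + g ^+ 4) //; ring.
  by rewrite (jacobi_sqr oN (coprimezXr 2 cf)) (jacobiM oN cN1) ?coprimezXr // (jacobi_sqr oN (coprimezXr 2 cg)) addbF => <-.
have J2 : ~~ jacobi N 2.
  have e : (N%:Z %| (f ^+ 2 + g ^+ 2) ^+ 2 - 2 * (f * g) ^+ 2)%Z.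
    by rewrite (_ : _ - _ = f ^+ 4 + g ^+ 4) //; ring.
  have cfg : coprimez N (2 * (f * g) ^+ 2) by rewrite coprimezMr c2 coprimezXr // coprimezMr cf.
  have := eq_jacobi e; rewrite jacobi_sqr //; last first.
    by rewrite -(@coprimez_pexpr 2) //; apply: coprimez_congr cfg.
  by rewrite jacobiM ?jacobi_sqr ?coprimezXr ?coprimezMr ?cf // addbF => <-.
by move: J2 JN; rewrite jacobi2_mod8 // jacobiN1_mod8 //; lia.
Qed.

End Arith.

(** * Coprime factors of perfect powers, and odd residues modulo 8 and 16 *)

Lemma gcdn_coprime_split s u v : coprime u v -> s %| u * v -> gcdn s u * gcdn s v = s.
Proof.
move=> co dv; apply/eqP; rewrite eqn_dvd; apply/andP; split.
  by rewrite Gauss_dvd ?dvdn_gcdl // (coprime_dvdl (dvdn_gcdr _ _)) // (coprime_dvdr (dvdn_gcdr _ _)).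
by rewrite muln_gcdl dvdn_gcd dvdn_mulr //= muln_gcdr dvdn_gcd dv dvdn_mull.
Qed.

Lemma gcdnX p u y : gcdn (p ^ y) (u ^ y) = gcdn p u ^ y.
Proof.
have [-> | p0] := posnP p; first by case: y => [|y]; rewrite ?gcdn1 // exp0n // !gcd0n.
have [[p' ep] [u' eu]] := (dvdnP (dvdn_gcdl p u), dvdnP (dvdn_gcdr p u)).
have co : coprime p' u'.
  by rewrite /coprime -(@eqn_pmul2r (gcdn p u)) ?gcdn_gt0 ?p0 // muln_gcdl -ep -eu mul1n.
move: (gcdn p u) ep eu => g -> ->; rewrite !expnMn -muln_gcdl.
by have := coprimeXl y (coprimeXr y co); rewrite /coprime => /eqP ->; rewrite mul1n.
Qed.

(** [gcdn p u ^ y = gcdn (p ^ y) (p * q) = p * gcdn (p ^ y.-1) q = p]. *)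
Lemma coprime_mul_expn p q u y : coprime p q -> p * q = u ^ y -> 0 < y -> p = gcdn p u ^ y.
Proof.
move=> co e; case: y e => // y e _.
by rewrite -gcdnX -e expnS -muln_gcdr (eqP (coprimeXl y co)) muln1.
Qed.

Lemma odd_sqr_mod16 n : odd n -> n ^ 2 %% 16 = if n %% 8 \in [:: 1; 7] then 1 else 9.
Proof.
move=> on.
have -> : n ^ 2 = n %/ 8 * (4 * (n %/ 8) + n %% 8) * 16 + (n %% 8) ^ 2.
  by rewrite {1}(divn_eq n 8) -!mulnn; ring.
rewrite modnMDl; have : odd (n %% 8) by rewrite odd_mod.
have : n %% 8 < 8 by rewrite ltn_mod.
by move: (n %% 8) => [|[|[|[|[|[|[|[|k]]]]]]]].
Qed.

Lemma odd_expn_mod8 s y : odd s -> odd y -> s ^ y %% 8 = s %% 8.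
Proof.
move=> os oy; rewrite -(odd_double_half y) oy expnD expn1 -mul2n expnM -modnMmr -modnXm.
have -> : s ^ 2 %% 8 = 1.
  have := odd_sqr_mod16 os; case: ifP => _; lia.
by rewrite exp1n modnMmr muln1.
Qed.

Section Arith.
Local Open Scope ring_scope.

(** Equal parities let the common factor [(k ^+ 2) ^+ odd X] be removed, leaving a sum of two fourth
    powers. *)
Lemma even_power_sum_mod8 (d : nat) (k : int) Z X : odd d -> coprimez d k -> odd Z = odd X ->
  (d%:Z %| (k ^+ 2) ^+ Z + (k ^+ 2) ^+ X)%Z -> (d %% 8 = 1)%N.
Proof.
move=> od ck oZX; rewrite -(odd_double_half Z) -(odd_double_half X) oZX !exprD -mulrDr.
rewrite Gauss_dvdzr ?coprimezXr // -!muln2 -!exprM => dv.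
apply: (@sum_fourth_powers_mod8 d (k ^+ Z./2) (k ^+ X./2)); rewrite ?coprimezXr //.
by rewrite -!exprM (_ : Z./2 * 4 = 2 * (Z./2 * 2))%N 1?(_ : X./2 * 4 = 2 * (X./2 * 2))%N //; lia.
Qed.

End Arith.

Lemma PoszX (k i : nat) : Posz (k ^ i) = (Posz k ^+ i)%R.
Proof. by elim: i => // i IH; rewrite expnS PoszM IH exprS. Qed.

(** * Fixed [m] and [n]: exclusion of odd [y] and [z] with [n] 1 modulo 8 *)

Section Triple.
Local Open Scope ring_scope.
Variables (m n N : nat) (a : int).
Hypotheses (n_gt0 : (0 < n)%N) (n_lt_m : (n < m)%N) (co_mn : coprime m n).
Hypotheses (m_mod8 : (m %% 8 = 4)%N) (n_odd : odd n).

Hypotheses (N_def : N = (m ^ 2 + n ^ 2)%N) (a_def : a = m%:Z ^+ 2 - n%:Z ^+ 2).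

Let N_E : N%:Z = m%:Z ^+ 2 + n%:Z ^+ 2.
Proof. by rewrite N_def PoszD -!mulnn !PoszM !expr2. Qed.
Let odd_N : odd N. Proof. by rewrite N_def oddD !oddX /= n_odd; lia. Qed.
Let co_Nm : coprimez N m.
Proof. by rewrite coprimezE coprime_sym /coprime /= N_def -mulnn gcdnMDl; apply: coprimeXr. Qed.
Let co_Nn : coprimez N n.
Proof. by rewrite coprimezE coprime_sym /coprime /= N_def addnC -[(n ^ 2)%N]mulnn gcdnMDl; apply: coprimeXr; rewrite coprime_sym. Qed.

Lemma no_odd_odd_solution (X y z : nat) : (n %% 8 = 1)%N -> odd y -> (0 < z)%N ->
  a ^+ X.*2 + (2 * m%:Z * n%:Z) ^+ y = N%:Z ^+ z -> False.
Proof.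
move=> n1 oy z0 eqn.
have N1 : (N %% 8 = 1)%N.
  by rewrite N_def -modnDm -(modnXm 2 8 m) -(modnXm 2 8 n) m_mod8 n1.
have c2 := coprimez_odd2 odd_N.
pose S := (m + n)%N.
have oS : odd S by rewrite /S oddD n_odd; lia.
have S5 : (S %% 8 = 5)%N by rewrite /S; lia.
have dS : (N%:Z %| S%:Z ^+ 2 - 2 * m%:Z * n%:Z)%Z.
  by apply/dvdzP; exists 1; rewrite N_E /S PoszD; ring.
have cb : coprimez N (2 * m%:Z * n%:Z) by rewrite !coprimezMr c2 co_Nm.
have cS : coprimez N S by rewrite -(@coprimez_pexpr 2) //; apply: coprimez_congr cb.
have da : (N%:Z %| a - -1 * (2 * n%:Z ^+ 2))%Z.
  by apply/dvdzP; exists 1; rewrite N_E a_def; ring.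
have c1 : coprimez N (-1) by rewrite coprimezN /coprimez gcdz1.
have cnn : coprimez N (2 * n%:Z ^+ 2) by rewrite coprimezMr c2 coprimezXr.
have ca : coprimez N a by apply: coprimez_congr da _; rewrite coprimezMr c1.
have J2 : jacobi N 2 = false by rewrite jacobi2_mod8 // N1.
have J1 : jacobi N (-1) = false by rewrite jacobiN1_mod8 // N1.
have Ja : jacobi N a = false.
  by rewrite (eq_jacobi da) (jacobiM odd_N c1 cnn) (jacobiM odd_N c2 (coprimezXr 2 co_Nn)) J1 J2 jacobi_sqr.
have Jmn : jacobi N m (+) jacobi N n = false.
  have c2m : coprimez N (2 * m%:Z) by rewrite coprimezMr c2.
  by have := eq_jacobi dS; rewrite (jacobi_sqr odd_N cS) (jacobiM odd_N c2m co_Nn) jacobiM // J2.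
(* With [b = 2 m n = S ^ 2] modulo [N], [P ^ 2 = n ^ 2 * b ^ y = - n ^ 2 * a ^ (2 X) = m ^ 2 * a ^
   (2 X) = Q ^ 2]. *)
pose P := n%:Z * S%:Z ^+ y; pose Q := m%:Z * a ^+ X.
have cP : coprimez N P by rewrite coprimezMr co_Nn coprimezXr.
have cQ : coprimez N Q by rewrite coprimezMr co_Nm coprimezXr.
have dPQ : (N%:Z %| P ^+ 2 - Q ^+ 2)%Z.
  rewrite (_ : _ - _ = n%:Z ^+ 2 * ((S%:Z ^+ 2) ^+ y - (2 * m%:Z * n%:Z) ^+ y)
     + n%:Z ^+ 2 * N%:Z ^+ z - N%:Z * a ^+ X.*2).
    apply: rpredB; last by apply: dvdz_mulr.
    by apply: rpredD; apply: dvdz_mull; [apply: dvdz_subX|apply: dvdz_exp].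
  by rewrite -eqn [in N%:Z * _]N_E /P /Q -muln2 exprM (exprAC _ 2 y); ring.
(* As [m ^ 2 = - n ^ 2] modulo [N], [w ^ 2] reduces to [n ^ 2 * ((P + Q) ^ 2 - (P - Q) ^ 2) = (2 n)
   ^ 2 * P * Q]; the cross term is a multiple of [P ^ 2 - Q ^ 2]. *)
pose w := n%:Z * (P + Q) + m%:Z * (P - Q).
have dw : (N%:Z %| w ^+ 2 - (2 * n%:Z) ^+ 2 * (P * Q))%Z.
  rewrite (_ : _ - _ = N%:Z * (P - Q) ^+ 2 + 2 * m%:Z * n%:Z * (P ^+ 2 - Q ^+ 2)).
    by apply: rpredD; [apply: dvdz_mulr|apply: dvdz_mull].
  by rewrite N_E /w; ring.
have c2n : coprimez N (2 * n%:Z) by rewrite coprimezMr c2.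
have cw : coprimez N w.
  rewrite -(@coprimez_pexpr 2) //; apply: coprimez_congr dw _.
  by rewrite coprimezMr coprimezXr // coprimezMr cP.
have JS : jacobi N S = false.
  have cPQ : coprimez N (P * Q) by rewrite coprimezMr cP.
  have := eq_jacobi dw; rewrite (jacobi_sqr odd_N cw) (jacobiM odd_N (coprimezXr 2 c2n) cPQ).
  rewrite (jacobi_sqr odd_N c2n) (jacobiM odd_N cP cQ) (jacobiM odd_N co_Nn (coprimezXr y cS)).
  rewrite (jacobiM odd_N co_Nm (coprimezXr X ca)) !jacobiX // oy Ja andbF.
  by move: Jmn; case: jacobi; case: jacobi; case: jacobi.
have coSN : coprime S N by rewrite coprime_sym.
have := jacobi_reciprocity oS odd_N coSN; rewrite JS => /(_ _) R.
have {}R : jacobi S N = false by apply: R; clear -N1; lia.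
(* From [2 N = (m + n) ^ 2 + (m - n) ^ 2], [2 N] is a square modulo [S], while there [N] has symbol
   1 and 2 has symbol -1. *)
have cSD : (S%:Z %| 2 * N%:Z - (m%:Z - n%:Z) ^+ 2)%Z.
  by apply/dvdzP; exists S%:Z; rewrite N_E /S PoszD; ring.
have cS2 := coprimez_odd2 oS.
have cSN : coprimez S (2 * N%:Z) by rewrite coprimezMr cS2 coprimezE.
have cD : coprimez S (m%:Z - n%:Z).
  rewrite -(@coprimez_pexpr 2) //; apply: coprimez_congr cSN.
  by rewrite -opprB rpredN.
by have := eq_jacobi cSD; rewrite (jacobi_sqr oS cD) (jacobiM oS cS2) // R jacobi2_mod8 // S5.
Qed.

(** * Residues modulo 16 and 8, and the parities of the exponents *)

Let dvd16_msqr : (16 %| m%:Z ^+ 2)%Z.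
Proof.
apply/dvdzP; exists ((m %/ 4)%:Z ^+ 2).
by rewrite {1}(_ : m = m %/ 4 * 4)%N ?PoszM; [ring | lia].
Qed.

Let dvd16_N : (16 %| N%:Z - n%:Z ^+ 2)%Z.
Proof. by rewrite (_ : _ - _ = m%:Z ^+ 2) // N_E; ring. Qed.

Let dvd16_a : (16 %| - a - n%:Z ^+ 2)%Z.
Proof. by rewrite (_ : _ - _ = - m%:Z ^+ 2) ?rpredN // a_def; ring. Qed.

Let nsqr_mod16 : (16 %| n%:Z ^+ 2 - (if (n %% 8 \in [:: 1; 7])%N then 1 else 9))%Z.
Proof.
have := odd_sqr_mod16 n_odd; have e := divn_eq (n ^ 2) 16; case: ifP => _ r;
  apply/dvdzP; exists (n ^ 2 %/ 16)%N%:Z; rewrite expr2 -PoszM mulnn {1}e r; lia.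
Qed.

Let dvd8_nsqr : (8 %| n%:Z ^+ 2 - 1)%Z.
Proof.
have /dvdzP [q] := nsqr_mod16; case: ifP => _ e; apply/dvdzP;
  [exists (q * 2)|exists (q * 2 + 1)]; lia.
Qed.

Let dvd8_of16 (u : int) : (16 %| u)%Z -> (8 %| u)%Z.
Proof. exact: dvdz_trans. Qed.

Let dvd8_N : (8 %| N%:Z - 1)%Z.
Proof.
rewrite (_ : _ - _ = (N%:Z - n%:Z ^+ 2) + (n%:Z ^+ 2 - 1)); last by ring.
by apply: rpredD => //; apply: dvd8_of16.
Qed.

Let dvd8_a : (8 %| - a - 1)%Z.
Proof.
rewrite (_ : _ - _ = (- a - n%:Z ^+ 2) + (n%:Z ^+ 2 - 1)); last by ring.
by apply: rpredD => //; apply: dvd8_of16.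
Qed.

(** Modulo 8 the equation becomes [(-1) ^+ x = 1]. Modulo 16 an odd [z] forces [n] to be 1 or 7
    modulo 8; symbols modulo [m - n] and [m + n] settle the remaining combinations. *)
Lemma exponent_parities x y z : (0 < x)%N -> (1 < y)%N ->
  a ^+ x + (2 * m%:Z * n%:Z) ^+ y = N%:Z ^+ z ->
  ~~ odd x /\ [\/ ~~ odd y && ~~ odd z, [&& odd y, odd z & n %% 8 == 1]%N
     | [&& odd y, ~~ odd z & n %% 8 == 5]%N].
Proof.
move=> x0 y1 eqn; set b := _ * n%:Z in eqn *.
have b16 : (16 %| b ^+ y)%Z.
  rewrite -(subnKC y1) exprD; apply: dvdz_mulr.
  rewrite (_ : b ^+ 2 = 4 * n%:Z ^+ 2 * m%:Z ^+ 2) /b; last by ring.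
  exact: dvdz_mull.
have ex : ~~ odd x.
  have : (8 %| (-1) ^+ x - 1)%Z.
    rewrite (_ : _ - _ = (N%:Z ^+ z - 1 ^+ z) - (a ^+ x - (-1) ^+ x) - b ^+ y).
      apply: rpredB; last exact: dvd8_of16.
      apply: rpredB; apply: dvdz_subX => //.
      by rewrite (_ : _ - _ = - (- a - 1)) ?rpredN //; ring.
    by rewrite -eqn expr1n; ring.
  by rewrite -signr_odd; case: odd.
split=> //.
(* Otherwise [N] and [- a] are both 9 modulo 16, where 9 has order 2; [x] even and [z] odd then give
   9 = 1, and [t] collects the difference -8. *)
have zmod : odd z -> (n %% 8 \in [:: 1; 7])%N.
  move=> oz; move: nsqr_mod16; case: ifP => // _ n9.
  have h9 w : (16 %| 9 ^+ w.*2 - 1)%Z.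
    by have := @dvdz_subX 16 (9 ^+ 2) 1 w isT; rewrite -exprM mul2n expr1n.
  have dN : (16 %| N%:Z ^+ z - 9 ^+ z)%Z.
    apply: dvdz_subX; rewrite (_ : _ - _ = (N%:Z - n%:Z ^+ 2) + (n%:Z ^+ 2 - 9)); last by ring.
    exact: rpredD.
  have da : (16 %| (- a) ^+ x - 9 ^+ x)%Z.
    apply: dvdz_subX; rewrite (_ : _ - _ = (- a - n%:Z ^+ 2) + (n%:Z ^+ 2 - 9)); last by ring.
    exact: rpredD.
  pose t := (N%:Z ^+ z - 9 ^+ z) + 9 * (9 ^+ z./2.*2 - 1) - b ^+ y
     - ((- a) ^+ x - 9 ^+ x) - (9 ^+ x./2.*2 - 1).
  have : (16 %| t)%Z.
    apply: rpredB => //; apply: rpredB => //; apply: rpredB => //; apply: rpredD => //.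
    exact: dvdz_mull.
  rewrite (_ : t = - 8) // /t.
  have ex2 : x = x./2.*2 by rewrite -[LHS](odd_double_half x) (negbTE ex).
  have oz2 : z = z./2.*2.+1 by rewrite -[LHS](odd_double_half z) oz.
  by rewrite -eqn exprNn -signr_odd (negbTE ex) [in 9 ^+ z]oz2 exprS [in 9 ^+ x]ex2; ring.
pose D := (m - n)%N; pose S := (m + n)%N.
have DE : D%:Z = m%:Z - n%:Z by rewrite /D subzn // ltnW.
have SE : S%:Z = m%:Z + n%:Z by [].
have oS : odd S by rewrite /S oddD n_odd; clear -m_mod8; lia.
have oD : odd D by rewrite /D oddB ?(ltnW n_lt_m) // n_odd; clear -m_mod8; lia.
have coDn : coprimez D n.
  rewrite coprimez_sym; apply: (@coprimez_congr _ _ m); last by rewrite coprimezE coprime_sym.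
  by apply/dvdzP; exists (-1); rewrite DE; ring.
have coSn : coprimez S n.
  rewrite coprimez_sym; apply: (@coprimez_congr _ _ m); last by rewrite coprimezE coprime_sym.
  by apply/dvdzP; exists 1; rewrite SE; ring.
have c2D := coprimez_odd2 oD; have c2S := coprimez_odd2 oS.
have cD : coprimez D (2 * n%:Z ^+ 2) by rewrite coprimezMr c2D coprimezXr.
have cS : coprimez S (2 * n%:Z ^+ 2) by rewrite coprimezMr c2S coprimezXr.
(* Modulo [D], [a] vanishes while [b] and [N] become [2 n ^ 2]; modulo [S] the same holds except
   that [b] becomes [- 2 n ^ 2]. *)
have JD : odd y && jacobi D 2 = odd z && jacobi D 2.
  have J2 : jacobi D (2 * n%:Z ^+ 2) = jacobi D 2.
    by rewrite (jacobiM oD c2D (coprimezXr 2 coDn)) (jacobi_sqr oD coDn) addbF.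
  rewrite -J2 -!jacobiX //; apply: eq_jacobi.
  rewrite (_ : _ - _ = (N%:Z ^+ z - (2 * n%:Z ^+ 2) ^+ z) - (b ^+ y - (2 * n%:Z ^+ 2) ^+ y)
     - a ^+ x); last by rewrite -eqn; ring.
  apply: rpredB; last first.
    by apply: dvdz_exp => //; apply/dvdzP; exists S%:Z; rewrite DE SE a_def; ring.
  apply: rpredB; apply: dvdz_subX; apply/dvdzP.
    by exists S%:Z; rewrite DE SE N_E; ring.
  by exists (2 * n%:Z); rewrite DE /b; ring.
have JS : odd y && (jacobi S (-1) (+) jacobi S 2) = odd z && jacobi S 2.
  have c1 : coprimez S (-1) by rewrite coprimezN /coprimez gcdz1.
  have J2 : jacobi S (2 * n%:Z ^+ 2) = jacobi S 2.
    by rewrite (jacobiM oS c2S (coprimezXr 2 coSn)) (jacobi_sqr oS coSn) addbF.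
  have cS1 : coprimez S (-1 * (2 * n%:Z ^+ 2)) by rewrite coprimezMr c1.
  rewrite -J2 -(jacobiM oS c1 cS) -!jacobiX //; apply: eq_jacobi.
  rewrite (_ : _ - _ = (N%:Z ^+ z - (2 * n%:Z ^+ 2) ^+ z)
     - (b ^+ y - (-1 * (2 * n%:Z ^+ 2)) ^+ y) - a ^+ x); last by rewrite -eqn; ring.
  apply: rpredB; last first.
    by apply: dvdz_exp => //; apply/dvdzP; exists D%:Z; rewrite DE SE a_def; ring.
  apply: rpredB; apply: dvdz_subX; apply/dvdzP.
    by exists D%:Z; rewrite DE SE N_E; ring.
  by exists (2 * n%:Z); rewrite SE /b; ring.
(* [D] and [S] are [4 - n] and [4 + n] modulo 8, so each symbol is a condition on [n]. *)
move: JD JS zmod; rewrite !jacobi2_mod8 // !jacobiN1_mod8 //.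
have DM : (D + n = m)%N by rewrite /D subnK // ltnW.
have : (S = m + n)%N by [].
have : (n %% 8 \in [:: 1; 3; 5; 7])%N.
  have : odd (n %% 8) by rewrite odd_mod.
  have : (n %% 8 < 8)%N by rewrite ltn_mod.
  by move: (n %% 8)%N => [|[|[|[|[|[|[|[|k]]]]]]]].
rewrite !inE; case: (odd y); case: (odd z) => /=; clear -m_mod8 DM; move: DM; move: D S => D S.
- by move=> DM n8 SE _ js /(_ isT) z8; constructor 2; lia.
- by move=> DM n8 SE jd js _; constructor 3; lia.
- by move=> DM n8 SE jd js /(_ isT) z8; exfalso; lia.
- by move=> *; constructor 1.
Qed.

(** * Factorization into coprime parts and descent *)

(** It is [- a] that is a square modulo [m], but [a] modulo [n]; hence the parity of [X] matters
    only for divisors of [n]. *)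
Let dvdm_N : (m %| N%:Z - n%:Z ^+ 2)%Z.
Proof. by apply/dvdzP; exists m%:Z; rewrite N_E; ring. Qed.

Let dvdm_a : (m %| - a - n%:Z ^+ 2)%Z.
Proof. by apply/dvdzP; exists (- m%:Z); rewrite a_def; ring. Qed.

Let dvdn_N : (n %| N%:Z - m%:Z ^+ 2)%Z.
Proof. by apply/dvdzP; exists n%:Z; rewrite N_E; ring. Qed.

Let dvdn_a : (n %| a - m%:Z ^+ 2)%Z.
Proof. by apply/dvdzP; exists (- n%:Z); rewrite a_def; ring. Qed.

Let coNa : coprimez N (- a).
Proof.
apply: (@coprimez_congr _ _ (2 * n%:Z ^+ 2)); last by rewrite coprimezMr coprimez_odd2 // coprimezXr.
by apply/dvdzP; exists (-1); rewrite N_E a_def; ring.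
Qed.

(** The sign in [(- a) ^+ X] makes both terms 1 modulo 8, so their sum is twice an odd number and
    their difference takes the factor [2 ^+ e.-1]. Coprimality of [p] and [q] comes from that of [N]
    and [a]. *)
Lemma descent_step X Z e U : (0 < Z)%N -> (5 <= e)%N -> (0 < U)%N ->
  N%:Z ^+ Z.*2 = a ^+ X.*2 + 2 ^+ e * U%:Z ->
  exists p q : nat, [/\ coprime p q, (p * q = U)%N,
    N%:Z ^+ Z + (- a) ^+ X = 2 * p%:Z & N%:Z ^+ Z - (- a) ^+ X = 2 ^+ e.-1 * q%:Z].
Proof.
move=> Z0 e5 U0 eqn.
set C := N%:Z ^+ Z; set A := (- a) ^+ X.
have eCA : (C + A) * (C - A) = 2 ^+ e * U%:Z.
  have eC : C ^+ 2 = N%:Z ^+ Z.*2 by rewrite /C -exprM muln2.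
  have eA : A ^+ 2 = a ^+ X.*2 by rewrite /A -exprM muln2 exprNn -signr_odd odd_double mul1r.
  have -> : (C + A) * (C - A) = C ^+ 2 - A ^+ 2 by ring.
  by rewrite eC eA eqn; ring.
have C0 : 0 < C by rewrite exprn_gt0 // ltz_nat; case: (N) odd_N.
have rhs0 : 0 < 2 ^+ e * U%:Z by rewrite mulr_gt0 ?exprn_gt0 ?ltz_nat.
have /andP [CA0 CB0] : (0 < C + A) && (0 < C - A) by rewrite -eCA in rhs0; clear -rhs0 C0; nia.
have C8 : (8 %| C - 1)%Z by have := dvdz_subX Z dvd8_N; rewrite expr1n.
have A8 : (8 %| A - 1)%Z by have := dvdz_subX X dvd8_a; rewrite expr1n.
have [P [eP P4]] : exists P : nat, C + A = 2 * P%:Z /\ odd P.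
  have /dvdzP [c ec] := C8; have /dvdzP [d ed] := A8.
  by exists (absz (4 * (c + d) + 1)%R); clear -ec ed CA0; lia.
have [E eE] : exists E : nat, C - A = 2 * E%:Z.
  by exists (absz (P%:Z - A)%R); clear -eP CB0; lia.
have ePE : (P * E = 2 ^ e.-2 * U)%N.
  have : 4 * (P%:Z * E%:Z) = 4 * (2 ^+ e.-2 * U%:Z).
    rewrite (_ : 4 * _ = (C + A) * (C - A)); last by rewrite eP eE; ring.
    by rewrite eCA; case: (e) e5 => [|[|k]] // _; rewrite !exprS /=; ring.
  by move/(mulfI (isT : 4 != 0 :> int)) => H; apply/eqP; rewrite -eqz_nat !PoszM PoszX; apply/eqP.
have /dvdnP [q eq] : (2 ^ e.-2 %| E)%N.
  by rewrite -(@Gauss_dvdr _ P) ?ePE ?dvdn_mulr // coprimeXl // coprime2n.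
have p2 : (0 < 2 ^ e.-2)%N by rewrite expn_gt0.
exists P, q; split => //; last 1 first.
- by rewrite eE eq; case: (e) e5 => [|[|k]] // _; rewrite /= exprS PoszM PoszX; ring.
- have /coprimezP [[u v] /= euv] : coprimez C A by rewrite coprimezXr // coprimezXl.
  have [eC eA] : C = P%:Z + E%:Z /\ A = P%:Z - E%:Z by clear -eP eE; lia.
  have : coprimez P q by apply/coprimezP; exists (u + v, (u - v) * (2 ^ e.-2)%N%:Z);
    rewrite /= -euv eC eA eq PoszM; ring.
  by rewrite coprimezE.
- by apply/eqP; rewrite -(eqn_pmul2l p2) -ePE eq; apply/eqP; ring.
Qed.

(* A step decreases e by one and halves Z, and e must stay at least 5. The third
   hypothesis ensures this: Z < y follows from c^Z < 2 s^y when the descent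
   continues, and e = 3y initially. *)
Lemma no_descent y : odd y -> (n %% 8 = 5)%N ->
  forall Z X e u v : nat, (0 < Z)%N -> (5 <= e)%N -> ((Z < y)%N -> (Z + 5 <= e)%N) ->
  odd u -> (u %| m)%N -> (v %| n)%N -> (v %% 8 = 5)%N ->
  N%:Z ^+ Z.*2 = a ^+ X.*2 + 2 ^+ e * ((u * v) ^ y)%N%:Z -> False.
Proof.
move=> oy n5; elim/ltn_ind => Z IH X e u v Z0 e5 eZ ou um vn v5 eqn.
have v0 : (0 < v)%N by case: (v) v5.
have y0 : (0 < y)%N by case: (y) oy.
have uv0 : (0 < u * v)%N by rewrite muln_gt0 v0 odd_gt0.
have U0 : (0 < (u * v) ^ y)%N by rewrite expn_gt0 uv0.
have [p [q [copq epq eP eQ]]] := descent_step Z0 e5 U0 eqn.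
have coqp : coprime q p by rewrite coprime_sym.
have eqp : (q * p = (u * v) ^ y)%N by rewrite mulnC.
set s := gcdn p (u * v); set r := gcdn q (u * v).
have ps : p = (s ^ y)%N by apply: coprime_mul_expn epq y0.
have qr : q = (r ^ y)%N by apply: coprime_mul_expn eqp y0.
have cosr : coprime s r.
  by apply: coprime_dvdl (dvdn_gcdl _ _) _; apply: coprime_dvdr (dvdn_gcdl _ _) _.
have sr : (s * r = u * v)%N.
  by apply: (expIn y0); rewrite -epq {1}ps {1}qr expnMn.
have couv : coprime u v by apply: coprime_dvdl um _; apply: coprime_dvdr vn _.
have s_uv : (s %| u * v)%N by rewrite dvdn_gcdr.
have r_uv : (r %| u * v)%N by rewrite dvdn_gcdr.
have es := gcdn_coprime_split couv s_uv; have er := gcdn_coprime_split couv r_uv.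
have ev : (gcdn s v * gcdn r v = v)%N.
  by rewrite ![gcdn _ v]gcdnC; apply: gcdn_coprime_split; rewrite // sr dvdn_mull.
have ov : odd v := dvdn_odd vn n_odd.
have os : odd s by apply: dvdn_odd s_uv _; rewrite oddM ou.
set s1 := gcdn s u in es; set s2 := gcdn s v in es ev; set r2 := gcdn r v in er ev.
set r1 := gcdn r u in er.
have os1 : odd s1 by apply: dvdn_odd (dvdn_gcdl _ _) os.
have os2 : odd s2 by apply: dvdn_odd (dvdn_gcdr _ _) ov.
have or2 : odd r2 by apply: dvdn_odd (dvdn_gcdr _ _) ov.
have dm (d k : nat) : (d %| u)%N -> (d %| m)%N by move/dvdn_trans; apply.
(* Modulo 16, [N ^ Z - (- a) ^ X] vanishes, both bases are 9, and 9 has order 2. *)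
have oXZ : odd Z = odd X.
  have n9 : (16 %| n%:Z ^+ 2 - 9)%Z by have := nsqr_mod16; rewrite n5.
  have dN : (16 %| N%:Z ^+ Z - 9 ^+ Z)%Z.
    by apply: dvdz_subX; rewrite (_ : _ - _ = (N%:Z - n%:Z ^+ 2) + (n%:Z ^+ 2 - 9)); [exact: rpredD | ring].
  have da : (16 %| (- a) ^+ X - 9 ^+ X)%Z.
    by apply: dvdz_subX; rewrite (_ : _ - _ = (- a - n%:Z ^+ 2) + (n%:Z ^+ 2 - 9)); [exact: rpredD | ring].
  have h9 w : (16 %| 9 ^+ w - 9 ^+ odd w)%Z.
    rewrite -{1}(odd_double_half w) exprD (_ : _ - _ = 9 ^+ odd w * (9 ^+ w./2.*2 - 1)); last by ring.
    by apply: dvdz_mull; have := @dvdz_subX 16 (9 ^+ 2) 1 w./2 isT; rewrite -exprM mul2n expr1n.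
  have hq : (16 %| 2 ^+ e.-1 * q%:Z)%Z.
    by apply: dvdz_mulr; case: (e) e5 => [|k] //= k4; rewrite -(subnKC (k4 : 4 <= k)%N) exprD dvdz_mulr.
  pose t := 2 ^+ e.-1 * q%:Z - (N%:Z ^+ Z - 9 ^+ Z) + ((- a) ^+ X - 9 ^+ X)
    - (9 ^+ Z - 9 ^+ odd Z) + (9 ^+ X - 9 ^+ odd X) : int.
  have ht : (16 %| t)%Z.
    by apply: rpredD => //; apply: rpredB => //; apply: rpredD => //; apply: rpredB.
  have et : t = 9 ^+ odd Z - 9 ^+ odd X by rewrite /t -eQ; ring.
  by move: ht; rewrite et; case: (odd Z); case: (odd X).
(* [p] is [N ^ Z] minus a multiple of [2 ^ (e - 2)], hence 1 modulo 8, and [s ^ y] has the class of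
   [s]. *)
have s8 : (s %% 8 = 1)%N.
  rewrite -(odd_expn_mod8 os oy) -ps.
  have C8 : (8 %| N%:Z ^+ Z - 1)%Z by have := dvdz_subX Z dvd8_N; rewrite expr1n.
  have : (8 %| p%:Z - 1)%Z.
    have -> : p%:Z - 1 = (N%:Z ^+ Z - 1) - 2 ^+ e.-2 * q%:Z.
      have E2 : 2 ^+ e.-1 = 2 * 2 ^+ e.-2 :> int by case: (e) e5 => [|[|k]] // _; rewrite -exprS.
      by move: eP eQ; rewrite E2 -mulrA; clear; lia.
    apply: rpredB => //; apply: dvdz_mulr; case: (e) e5 => [|[|k]] //= k4.
    by rewrite -(subnKC (k4 : 3 <= k)%N) exprD dvdz_mulr.
  by clear; lia.
have dvP (d : nat) : (d %| s)%N -> (d %| N%:Z ^+ Z + (- a) ^+ X)%Z.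
  move=> ds; rewrite eP; apply: dvdz_mull; rewrite dvdzE /= ps.
  by apply: dvdn_exp.
have dvQ (d : nat) : (d %| r)%N -> (d %| N%:Z ^+ Z - (- a) ^+ X)%Z.
  move=> dr; rewrite eQ; apply: dvdz_mull; rewrite dvdzE /= qr.
  by apply: dvdn_exp.
have dvz (d : nat) (k : nat) (w : int) : (d %| k)%N -> (k%:Z %| w)%Z -> (d%:Z %| w)%Z.
  by move=> dk; apply: dvdz_trans.
(* Modulo [s1], a divisor of [m], the vanishing sum [N ^ Z + (- a) ^ X] is
   [n ^ (2 Z) + n ^ (2 X)]. *)
have s18 : (s1 %% 8 = 1)%N.
  have s1m : (s1 %| m)%N by apply: dvdn_trans (dvdn_gcdr _ _) um.
  apply: (@even_power_sum_mod8 _ n Z X) => //; first by rewrite coprimezE; apply: coprime_dvdl s1m _.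
  rewrite (_ : _ + _ = (N%:Z ^+ Z + (- a) ^+ X) - (N%:Z ^+ Z - (n%:Z ^+ 2) ^+ Z)
     - ((- a) ^+ X - (n%:Z ^+ 2) ^+ X)); last by ring.
  apply: rpredB; last by apply: dvz s1m _; apply: dvdz_subX.
  by apply: rpredB; [apply: dvP; apply: dvdn_gcdl | apply: dvz s1m _; apply: dvdz_subX].
have coM (d : nat) : (d %| v)%N -> coprimez d m.
  move=> dv; rewrite coprimezE; apply: coprime_dvdl (dvdn_trans dv vn) _.
  by rewrite coprime_sym.
have dvnX (d : nat) : (d %| v)%N -> (d %| N%:Z ^+ Z - (m%:Z ^+ 2) ^+ Z)%Z
     /\ (d %| a ^+ X - (m%:Z ^+ 2) ^+ X)%Z.
  by move=> dv; split; apply: dvz (dvdn_trans dv vn) _; apply: dvdz_subX.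
have E8 (i j k : nat) : (i * j = k)%N -> (k %% 8 = (i %% 8) * (j %% 8) %% 8)%N.
  by move=> <-; rewrite modnMm.
(* For [X] odd, [(- a) ^ X] is [- m ^ (2 X)] modulo divisors of [n], so the difference turns into a
   sum and [r2] is 1 modulo 8. So is [s2], by [s = s1 * s2], and then [v = s2 * r2]. *)
have [oX | eX] := boolP (odd X).
  have r28 : (r2 %% 8 = 1)%N.
    have r2v : (r2 %| v)%N := dvdn_gcdr _ _.
    have [d1 d2] := dvnX _ r2v; have d3 := dvQ _ (dvdn_gcdl r v).
    apply: (@even_power_sum_mod8 _ m Z X) => //; first exact: coM.
    rewrite (_ : _ + _ = (N%:Z ^+ Z - (- a) ^+ X) - (N%:Z ^+ Z - (m%:Z ^+ 2) ^+ Z)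
       - (a ^+ X - (m%:Z ^+ 2) ^+ X)); last by rewrite exprNn -signr_odd oX; ring.
    by apply: rpredB => //; apply: rpredB.
  have := E8 _ _ _ ev; have := E8 _ _ _ es; rewrite s8 s18 r28 v5.
  by have := ltn_pmod s2 (isT : 0 < 8)%N; clear; lia.
(* For [X] even the sum [N ^ Z + (- a) ^ X] serves instead, and the class 5 of [v] passes to
   [r2]. *)
have s28 : (s2 %% 8 = 1)%N.
  have s2v : (s2 %| v)%N := dvdn_gcdr _ _.
  have [d1 d2] := dvnX _ s2v; have d3 := dvP _ (dvdn_gcdl s v).
  apply: (@even_power_sum_mod8 _ m Z X) => //; first exact: coM.
  rewrite (_ : _ + _ = (N%:Z ^+ Z + (- a) ^+ X) - (N%:Z ^+ Z - (m%:Z ^+ 2) ^+ Z)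
     - (a ^+ X - (m%:Z ^+ 2) ^+ X)); last by rewrite exprNn -signr_odd (negbTE eX); ring.
  by apply: rpredB => //; apply: rpredB.
have r28 : (r2 %% 8 = 5)%N.
  have := E8 _ _ _ ev; rewrite s28 v5.
  by have := ltn_pmod r2 (isT : 0 < 8)%N; clear; lia.
have eZ' : ~~ odd Z by rewrite oXZ.
have Z2 : Z = Z./2.*2 by rewrite -[LHS](odd_double_half Z) (negbTE eZ').
have X2 : X = X./2.*2 by rewrite -[LHS](odd_double_half X) (negbTE eX).
have aX : (- a) ^+ X = a ^+ X./2.*2.
  by rewrite exprNn -signr_odd (negbTE eX) mul1r -X2.
(* [N ^ Z <= 2 p <= (2 u v) ^ y < N ^ y]: the first bound holds because [(- a) ^ X] is a square, the
   last because [2 m n < m ^ 2 + n ^ 2]. *)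
have Zy : (Z < y)%N.
  have N1 : (1 < N)%N by rewrite N_def; clear -n_lt_m n_gt0; nia.
  rewrite -(ltn_exp2l _ _ N1) -ltz_nat PoszX.
  have lt1 : N%:Z ^+ Z <= 2 * p%:Z.
    rewrite -eP lerDl aX -muln2 exprM sqr_ge0 //.
  apply: le_lt_trans lt1 _; rewrite -PoszM ltz_nat.
  have lt2 : (p <= (u * v) ^ y)%N by rewrite -epq; apply: leq_pmulr; case: (q) eqp U0 => // <-.
  have lt3 : (2 * p <= (2 * (u * v)) ^ y)%N.
    by rewrite expnMn leq_mul // -{1}(expn1 2) leq_exp2l.
  apply: leq_ltn_trans lt3 _; rewrite ltn_exp2r //.
  have le4 : (u * v <= m * n)%N by rewrite leq_mul // dvdn_leq //; apply: leq_trans n_lt_m.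
  by rewrite N_def; clear -le4 n_lt_m; nia.
have Ze := eZ Zy.
(* The difference [N ^ Z - a ^ X = 2 ^ (e - 1) * (r1 * r2) ^ y] is the next instance. *)
apply: (IH Z./2 _ X./2 e.-1 r1 r2) => //.
- by clear -Z0 Z2; lia.
- by clear -Z0 Z2; lia.
- by clear -Z0 Z2 Ze; lia.
- by clear -Z0 Z2 Ze; lia.
- by apply: dvdn_odd (dvdn_gcdr _ _) ou.
- by apply: dvdn_trans (dvdn_gcdr _ _) um.
- by apply: dvdn_trans (dvdn_gcdr _ _) vn.
by rewrite er -qr -aX -Z2 -eQ; ring.
Qed.

End Triple.

(** * Reduction to the three parity cases *)

Theorem mainTheorem4 (m n x y z : nat) :
  0 < n -> n < m -> coprime m n -> m <> n %[mod 2] ->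
  4 %| m -> ~~ (8 %| m) ->
  0 < x -> 0 < y -> 0 < z ->
  (m ^ 2 - n ^ 2) ^ x + (2 * m * n) ^ y = (m ^ 2 + n ^ 2) ^ z ->
  y = 1 \/ [/\ x = 0 %[mod 2], y = 0 %[mod 2] & z = 0 %[mod 2]].
Proof.
move=> n0 nm co par m4 m8 x0 y0 z0 eqn.
have on : odd n by clear -par m4; lia.
have {}m8 : m %% 8 = 4 by clear -m8 m4; lia.
have [y1|y1] := leqP y 1; [left; lia | right].
pose N := m ^ 2 + n ^ 2; pose a : int := (m%:Z ^+ 2 - n%:Z ^+ 2)%R.
have eqz : (a ^+ x + (2 * m%:Z * n%:Z) ^+ y = N%:Z ^+ z)%R.
  by rewrite -PoszX -eqn PoszD !PoszX !PoszM -subzn ?leq_exp2r ?(ltnW nm) //.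
have [ex] := exponent_parities n0 nm co m8 on (erefl N) (erefl a) x0 y1 eqz.
have x2 : x = x./2.*2 by rewrite -[LHS](odd_double_half x) (negbTE ex).
case=> [/andP [ey ez] | /and3P [oy _ /eqP n1] | /and3P [oy ez /eqP n5]].
- by rewrite !modn2 (negbTE ex) (negbTE ey) (negbTE ez).
- by case: (no_odd_odd_solution n0 nm co m8 on (erefl N) (erefl a) n1 oy z0 (X := x./2)); rewrite -x2.
have z2 : z = z./2.*2 by rewrite -[LHS](odd_double_half z) (negbTE ez).
(* With [m = 4 u] and [u] odd, [2 m n = 8 u n], whence [e = 3 y]; [y] odd and above 1 gives the
   bounds on [e]. *)
case: (no_descent n0 nm co m8 on (erefl N) (erefl a) oy n5
   (Z := z./2) (X := x./2) (e := 3 * y) (u := m %/ 4) (v := n)) => //.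
- by clear -z0 z2; lia.
- by clear -y1 oy; lia.
- by clear -y1 oy; lia.
- by clear -m8; lia.
- by apply/dvdnP; exists 4; clear -m4; lia.
rewrite -z2 -x2 -eqz PoszX PoszM exprM -exprMn.
by rewrite {1}(_ : m = m %/ 4 * 4) ?PoszM; [congr (_ + _ ^+ _)%R; ring | clear -m4; lia].
Qed.
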